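(* Let $q=p^r$ for some prime $p$ and some positive integer $r$, let $n\geq 2$ be an integer, and consider the finite field extension $\mathbb{F}_q\subset\mathbb{F}_{q^n}$. Let $d(n)$ denote the number of positive divisors of $n$, and suppose $d(n)<q+2$. Then $$\psi(\mathbb{F}_{q^n},\mathbb{F}_q)+\phi(\mathbb{F}_{q^n},\mathbb{F}_q)=n.$$
   Context: For a finite field extension $K\subset F$ (with $F\neq K$), a $K$-subspace $A$ of $F$ is called a primitive $K$-subspace of $F$ if $K(a)=F$ for every $a\in A\setminus\{0\}$. Define $$\psi(F,K)=\max\{[M:K] : M \text{ is a field with } K\subseteq M\subsetneq F\}$$ (so that $M=K$ is allowed, $M=F$ is not, and $1\le\psi(F,K)<[F:K]$), and $$\phi(F,K)=\max\{\dim_K V : V \text{ is a primitive } K\text{-subspace of } F\}.$$ *)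

(* Defs.v *)
From HB Require Import structures.
From mathcomp Require Import all_boot all_order all_algebra all_field.
From mathcomp Require Import boolp.

Set Implicit Arguments.
Unset Strict Implicit.
Unset Printing Implicit Defensive.

Import GRing.Theory.
Local Open Scope ring_scope.

Section PrimitiveSubspaces.

Variables (K : fieldType) (F : fieldExtType K).

(* The base field K sits in F as [1%AS], so [<<1; a>>] is K(a). *)
Definition primitive_subspace (A : {vspace F}) : Prop :=
  forall a : F, a \in A -> a != 0 -> <<1; a>>%VS = {:F}%VS.

(* Every [{subfield F}] contains K, so M ranges over all the intermediate
   fields other than F.  The bound on m excludes nothing, since
   [\dim M <= \dim {:F}]; it only makes the range of the maximum finite. *)
Definition psi : nat :=
  \max_(m < (\dim {:F}).+1 |
     `[< exists M : {subfield F}, (M : {vspace F}) <> {:F}%VS /\ \dim M = m >]) m.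

Definition phi : nat :=
  \max_(m < (\dim {:F}).+1 |
     `[< exists V : {vspace F}, primitive_subspace V /\ \dim V = m >]) m.

End PrimitiveSubspaces.

Arguments psi {K} F.
Arguments phi {K} F.

(* Main.v *)
Require Import Defs.
From mathcomp Require Import all_boot all_order all_algebra all_field.
From mathcomp Require Import boolp zify.

(** A subspace V of F is primitive exactly when it meets every proper
    intermediate field trivially: a nonzero element a of V that fails to
    generate F lies in the proper subfield K(a).  Hence, for V primitive and M
    proper, V + M is a direct sum and dim V + dim M <= n; this gives
    psi + phi <= n ([psi_phi_le]), over any K.

    For the reverse inequality one needs a single subspace of dimension n - psi
    that meets all proper intermediate fields trivially.  Over a finite field
    an intermediate field is determined by its degree
    ([subfield_eq_dim]), which divides n, so there are at most d(n) - 1 <= q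
    proper ones, each of dimension at most psi.  The rest is linear algebra: at
    most q subspaces of codimension at least k in a space over a field with q
    elements have a common disjoint subspace of dimension k
    ([common_disjoint_subspace]).  It is built by adding one vector at a time,
    which is possible because q proper subspaces never cover the whole space
    ([exists_notin_subspaces]). *)

Set Implicit Arguments.
Unset Strict Implicit.
Unset Printing Implicit Defensive.

Import GRing.Theory.
Local Open Scope ring_scope.

(** * Disjointness from a few subspaces over a finite field *)

Section SubspacesOverFiniteField.

Variables (K : finFieldType) (vT : vectType K).
Implicit Types (U V : {vspace vT}) (Us : seq {vspace vT}).

(** Destructing [vT] makes its structure convertible to the one that
    [finvect_type] rebuilds on the same carrier, so [card_vspace] applies. *)
Lemma card_subspace U :
  #|[set v : finvect_type vT | (v : vT) \in U]| = (#|K| ^ \dim U)%N.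
Proof.
by rewrite cardsE; case: vT U => T cT U; apply: (@card_vspace K (finvect_type _)).
Qed.

Lemma card_finvect : #|finvect_type vT| = (#|K| ^ \dim {:vT})%N.
Proof.
by rewrite -card_subspace cardsE; apply/esym/eq_card => v; rewrite !inE memvf.
Qed.

(** Counting nonzero vectors only is what makes the bound sharp enough: with
    the zero vector included, q hyperplanes would be allowed q ^ n vectors. *)
Lemma card_nonzero_cover Us :
    (forall U, U \in Us -> \dim U < \dim {:vT})%N ->
  (#|[set v : finvect_type vT |
        ((v : vT) != 0%R) && has (fun U => (v : vT) \in U) Us]|
     <= size Us * (#|K| ^ (\dim {:vT}).-1).-1)%N.
Proof.
elim: Us => [|U Us IHUs] ltUs.
  by rewrite eq_card0 // => v; rewrite !inE andbF.
set A := [set v : finvect_type vT | _] in IHUs.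
pose B := [set v : finvect_type vT | (v : vT) \in U] :\ (0 : finvect_type vT).
have cardB : (#|B| <= (#|K| ^ (\dim {:vT}).-1).-1)%N.
  have := cardsD1 (0 : finvect_type vT) [set v : finvect_type vT | (v : vT) \in U].
  rewrite inE mem0v card_subspace => cardU.
  have ltU : (\dim U < \dim {:vT})%N by apply: ltUs; rewrite mem_head.
  have leU : (#|K| ^ \dim U <= #|K| ^ (\dim {:vT}).-1)%N.
    by rewrite leq_exp2l ?finNzRing_gt1 //; lia.
  by rewrite -/B in cardU; rewrite cardU in leU; lia.
have cardA : (#|A| <= size Us * (#|K| ^ (\dim {:vT}).-1).-1)%N.
  by apply: IHUs => W UsW; apply: ltUs; rewrite inE UsW orbT.
rewrite /= mulSn; apply: leq_trans (leq_add cardB cardA).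
apply: leq_trans (leq_card_setU B A); apply: subset_leq_card.
by apply/subsetP=> v; rewrite !inE => /andP[-> /orP[] ->]; rewrite ?orbT.
Qed.

Lemma exists_notin_subspaces Us :
    (size Us <= #|K|)%N -> (forall U, U \in Us -> \dim U < \dim {:vT})%N ->
  exists v : vT, forall U, U \in Us -> v \notin U.
Proof.
move=> leUs ltUs.
have [/hasP[v _ /allP vP] | noV] :=
    boolP (has (fun v : finvect_type vT => all (fun U => (v : vT) \notin U) Us)
               (enum (finvect_type vT))).
  by exists v.
exfalso; have := card_nonzero_cover ltUs.
have -> : [set v : finvect_type vT |
    ((v : vT) != 0) && has (fun U => (v : vT) \in U) Us]
  = [set~ (0 : finvect_type vT)].
  apply/setP=> v; rewrite !inE; case: eqVneq => //= _.
  move/hasPn/(_ v): noV; rewrite mem_enum => /(_ isT) /allPn[U UsU].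
  by rewrite negbK => Uv; apply/hasP; exists U.
rewrite cardsC1 card_finvect.
have q_gt1 : (1 < #|K|)%N := finNzRing_gt1 K.
have n_gt0 : (0 < \dim {:vT})%N.
  case: Us noV ltUs {leUs} => [|U Us] noV ltUs.
    by move/hasPn/(_ 0): noV; rewrite mem_enum => /(_ isT).
  by apply: leq_ltn_trans (ltUs U _); rewrite ?mem_head.
have e_gt0 : (0 < #|K| ^ (\dim {:vT}).-1)%N by rewrite expn_gt0 ltnW.
rewrite -[X in (_ ^ X)%N](prednK n_gt0) expnS.
(* q (q ^ (n - 1) - 1) < q ^ n - 1 because q > 1 *)
move: (#|K| ^ _)%N e_gt0 => e e_gt0.
move: (#|K|) (size Us) q_gt1 leUs => q s q_gt1 leUs.
by nia.
Qed.

(** Induction on k: if v lies outside every U, then a subspace V disjoint from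
    every U + <v> gives the subspace V + <v>, which is disjoint from every U.
    The list is nonempty so that v and V are themselves independent. *)
Lemma common_disjoint_subspace k Us :
    (0 < size Us <= #|K|)%N ->
    (forall U, U \in Us -> \dim U + k <= \dim {:vT})%N ->
  exists2 V, \dim V = k & forall U, U \in Us -> (U :&: V)%VS = 0%VS.
Proof.
elim: k Us => [|k IHk] Us /andP[Us_gt0 leUs] ltUs.
  by exists 0%VS => [|U _]; rewrite ?dimv0 ?capv0.
have [v vP] : exists v : vT, forall U, U \in Us -> v \notin U.
  by apply: exists_notin_subspaces => // U /ltUs; lia.
have [||V dimV disjV] := IHk [seq (U + <[v]>)%VS | U <- Us].
- by rewrite size_map Us_gt0.
- move=> _ /mapP[U UsU ->]; have := ltUs U UsU.
  have := dimv_add_leqif U <[v]>%VS => -[+ _]; rewrite dim_vline.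
  by case: (v != 0); lia.
have disj U w : U \in Us -> w \in (U + <[v]>)%VS -> w \in V -> w = 0.
  move=> UsU Uw Vw; apply/eqP; rewrite -memv0.
  by rewrite -(disjV _ (map_f _ UsU)) memv_cap Uw.
case: Us Us_gt0 vP disj {leUs ltUs disjV} => // U0 Us _ vP disj.
exists (V + <[v]>)%VS.
  have v_neq0 : v != 0.
    by apply: contraNneq (vP _ (mem_head _ _)) => ->; rewrite mem0v.
  rewrite dimv_disjoint_sum ?dimV ?dim_vline ?v_neq0 ?addn1 //.
  apply/eqP; rewrite -subv0; apply/subvP=> w; rewrite memv_cap memv0.
  case/andP=> Vw vw; apply/eqP/(disj U0); rewrite ?mem_head //.
  exact: subvP (addvSr _ _) _ vw.
move=> U UsU; apply/eqP; rewrite -subv0; apply/subvP=> w; rewrite memv_cap memv0.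
case/andP=> Uw /memv_addP[x Vx [_ /vlineP[c ->] Dw]].
have x0 : x = 0.
  apply: (disj U) => //; rewrite -[x](addrK (c *: v)) -Dw.
  by rewrite -scaleNr memv_add // memvZ ?memv_line.
rewrite Dw x0 add0r in Uw *; have [-> | c_neq0] := eqVneq c 0.
  by rewrite scale0r.
by case/negP: (vP U UsU); rewrite -[v](scalerK c_neq0) memvZ.
Qed.

End SubspacesOverFiniteField.

(** * Primitive subspaces and intermediate fields *)

Section PrimitiveSubspaces.

Variables (K : fieldType) (F : fieldExtType K).
Implicit Types (M : {subfield F}) (V : {vspace F}).

Lemma leq_psi M : (M : {vspace F}) <> {:F}%VS -> (\dim M <= psi F)%N.
Proof.
move=> Mproper; have leM : (\dim M < (\dim {:F}).+1)%N by rewrite ltnS dimvS ?subvf.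
by apply: (leq_bigmax_cond (Ordinal leM)); apply/asboolP; exists M.
Qed.

Lemma leq_phi V : primitive_subspace V -> (\dim V <= phi F)%N.
Proof.
move=> Vprim; have leV : (\dim V < (\dim {:F}).+1)%N by rewrite ltnS dimvS ?subvf.
by apply: (leq_bigmax_cond (Ordinal leV)); apply/asboolP; exists V.
Qed.

Lemma primitive_subspaceP V :
  primitive_subspace V <->
  (forall M, (M : {vspace F}) <> {:F}%VS -> (M :&: V)%VS = 0%VS).
Proof.
split=> [Vprim M Mproper | disjV a Va a_neq0].
  apply/eqP; rewrite -subv0; apply/subvP=> a; rewrite memv_cap memv0.
  case/andP=> Ma Va; apply: contra_notT Mproper => a_neq0.
  by apply/eqP; rewrite eqEsubv subvf -(Vprim a) // sub_adjoin1v.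
apply: contrapT => /(disjV <<1; a>>%AS) disja; case/negP: a_neq0.
by rewrite -memv0 -disja memv_cap Va memv_adjoin.
Qed.

Lemma psi_phi_le : (psi F + phi F <= \dim {:F})%N.
Proof.
have le_phi : (phi F <= \dim {:F})%N by apply/bigmax_leqP=> i _; rewrite -ltnS.
suff: (psi F <= \dim {:F} - phi F)%N by lia.
apply/bigmax_leqP=> m /asboolP[M [Mproper <-]].
have leM : (\dim M <= \dim {:F})%N by rewrite dimvS ?subvf.
suff: (phi F <= \dim {:F} - \dim M)%N by lia.
apply/bigmax_leqP=> k /asboolP[V [/primitive_subspaceP Vprim <-]].
by rewrite leq_subRL // -dimv_disjoint_sum ?dimvS ?subvf //; apply: Vprim.
Qed.

End PrimitiveSubspaces.

Section FiniteFieldExtension.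

Variables (K : finFieldType) (F : fieldExtType K).
Implicit Types (M N : {subfield F}).

(** An intermediate field of degree d consists of the roots of X^(q^d) - X. *)
Lemma subfield_eq_dim M N : \dim M = \dim N -> (M : {vspace F}) = N.
Proof.
by move=> eq_dim; apply/vspaceP=> a; rewrite !Fermat's_little_theorem eq_dim.
Qed.

(** The zero subspace stands in for a degree at which no proper intermediate
    field is known to exist: only an upper bound on their number matters. *)
Lemma proper_subfield_of_dim (d : nat) :
  exists U : {vspace F}, (\dim U <= psi F)%N /\
    (forall M, (M : {vspace F}) <> {:F}%VS -> \dim M = d -> (M : {vspace F}) = U).
Proof.
have [[M [Mproper dimM]] | noM] :=
    pselect (exists M, (M : {vspace F}) <> {:F}%VS /\ \dim M = d).
  exists M; split=> [|N _ dimN]; first exact: leq_psi.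
  by apply: subfield_eq_dim; rewrite dimN.
exists 0%VS; split=> [|M Mproper dimM]; first by rewrite dimv0.
by case: noM; exists M.
Qed.

Lemma psi_phi_ge :
  (size (divisors (\dim {:F})) < #|K| + 2)%N ->
  (1 < \dim {:F})%N -> (\dim {:F} <= psi F + phi F)%N.
Proof.
set n : nat := \dim {:F} => ltdn n_gt1; have n_gt0 : (0 < n)%N by lia.
have [U UP] := choice proper_subfield_of_dim.
pose Us := [seq U d | d <- rem n (divisors n)].
have mem_proper_div d : d \in rem n (divisors n) = (d != n) && (d %| n)%N.
  by rewrite mem_rem_uniq ?divisors_uniq // !inE -dvdn_divisors.
have psi_le : (psi F <= n)%N := leq_trans (leq_addr _ _) (psi_phi_le F).
have sizeUs : (0 < size Us <= #|K|)%N.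
  have d1 : 1%N \in rem n (divisors n).
    by rewrite mem_proper_div dvd1n andbT; lia.
  have dn : n \in divisors n by rewrite -dvdn_divisors.
  have sizeD : size Us = (size (divisors n)).-1 by rewrite size_map size_rem.
  apply/andP; split; last by lia.
  by rewrite size_map; case: (rem _ _) d1.
have [_ /mapP[d _ ->]|V dimV disjV] :=
    @common_disjoint_subspace K F (n - psi F)%N Us sizeUs.
  by have [leU _] := UP d; rewrite -/n; lia.
suff /leq_phi : primitive_subspace V by rewrite dimV; lia.
apply/primitive_subspaceP=> M Mproper.
have [_ /(_ M Mproper erefl) ->] := UP (\dim M).
apply: disjV; apply: map_f; rewrite mem_proper_div field_dimS ?subvf // andbT.
apply: contra_not_neq Mproper => dimM.
by apply/eqP; rewrite eqEdim subvf /= dimM.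
Qed.

End FiniteFieldExtension.

Theorem theorem1 (p r q n : nat) (K : finFieldType) (F : fieldExtType K)
  (hp : prime p) (hr : (0 < r)%N) (hq : q = (p ^ r)%N) (hn : (2 <= n)%N)
  (hK : #|K| = q) (hF : #|finvect_type F| = (q ^ n)%N)
  (hd : (size (divisors n) < q + 2)%N) :
  (psi F + phi F)%N = n.
Proof.
have dimF : \dim {:F} = n.
  apply: (expnI (finNzRing_gt1 K)).
  by rewrite -card_finvect hF hK.
apply/eqP; rewrite eqn_leq -{1 2}dimF psi_phi_le.
by rewrite psi_phi_ge ?dimF ?hK.
Qed.
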